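(* Let $(G,S)$ be an even Coxeter system whose labelled graph $\Gamma$ is triangle-free and star-regular. Then the geodesic growth of $G$ with respect to $S$ depends only on $|S|$ and on the isomorphism class (as a labelled graph) of the star of the vertices of $\Gamma$. In particular: if $(G_1,S_1)$ and $(G_2,S_2)$ are triangle-free, star-regular, even Coxeter systems with labelled graphs $\Gamma_1$ and $\Gamma_2$, with $|S_1|=|S_2|$ and $\mathrm{St}(v)\cong\mathrm{St}(u)$ as labelled graphs for $v\in V\Gamma_1$, $u\in V\Gamma_2$, then $G_1$ and $G_2$ have the same geodesic growth, i.e. $\gamma_{(G_1,S_1)}=\gamma_{(G_2,S_2)}$.
   Context: A Coxeter system $(G,S)$ is a group $G$ with a finite generating set $S=\{s_i\}_{i\in I}$ for which $G$ has the presentation $\langle S\mid (s_is_j)^{m_{i,j}}=1,\ i,j\in I\rangle$, where $m_{i,i}=1$, $m_{i,j}=m_{j,i}$ is a non-negative integer for $i\ne j$, and $m_{i,j}=0$ means that there is no relation between $s_i$ and $s_j$ ($g^0=1$). It is even if all $m_{i,j}$, $i\neq j$, are even. Its labelled graph $\Gamma=\Gamma(G,S)$ is the simplicial graph with vertex set $S$, an edge $\{s_i,s_j\}$ ($i\ne j$) whenever $m_{i,j}\neq 0$, and this edge labelled by the number $m_{i,j}$. The system is triangle-free if no three vertices of $\Gamma$ span a complete graph. For a vertex $v$, $\mathrm{St}(v)$ denotes the labelled subgraph of $\Gamma$ spanned by $v$ and all vertices adjacent to $v$, with the edge labels inherited from $\Gamma$. The graph $\Gamma$ is star-regular if for every pair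 of vertices $u,v$ there is an isomorphism between $\mathrm{St}(u)$ and $\mathrm{St}(v)$ as graphs with labelled edges (isomorphisms preserve the edge labels $m_{i,j}$, not the names of vertices). The geodesic growth function is $\gamma_{(G,S)}(r)=|\{w\in S^*: |w|=|\pi(w)|=r\}|$, where $\pi\colon S^*\to G$ is the natural projection from the free monoid on $S$ and $|\pi(w)|$ is the word length with respect to $S$. *)

(* Defs.v *)
From HB Require Import structures.
From mathcomp Require Import all_boot finmap boolp.

Set Implicit Arguments.
Unset Strict Implicit.
Unset Printing Implicit Defensive.

Local Open Scope fset_scope.
Local Open Scope group_scope.

Section Presentation.
Variable X : Type.

(* Words in X and its formal inverses: (x, true) is x, (x, false) is x^-1. *)
Definition gword := seq (X * bool).

(* Equality in the free group on X modulo the normal closure of the relators R. *)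
Inductive pres_eq (R : gword -> Prop) : gword -> gword -> Prop :=
| PresRefl u : pres_eq R u u
| PresSym u v : pres_eq R u v -> pres_eq R v u
| PresTrans u v w : pres_eq R u v -> pres_eq R v w -> pres_eq R u w
| PresCancel u v x b : pres_eq R (u ++ [:: (x, b); (x, ~~ b)] ++ v) (u ++ v)
| PresRelator u v r : R r -> pres_eq R (u ++ r ++ v) (u ++ v).

Definition gword_val (G : groupType) (s : X -> G) (w : gword) : G :=
  \prod_(p <- w) (if p.2 then s p.1 else (s p.1)^-1).

(* G = < X | R > via s: the map from the free group on X to G is onto, and its
   kernel is the normal closure of R. *)
Definition has_presentation (G : groupType) (s : X -> G) (R : gword -> Prop) :=
  (forall g : G, exists w, gword_val s w = g) /\
  (forall u v, gword_val s u = gword_val s v <-> pres_eq R u v).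

End Presentation.

Section Coxeter.
Variables (G : groupType) (S : {fset G}).

(* The relator (s t)^(m s t), which is the empty word when m s t = 0. *)
Definition coxeter_relator (m : S -> S -> nat) (s t : S) : gword S :=
  flatten (nseq (m s t) [:: (s, true); (t, true)]).

Definition coxeter_system (m : S -> S -> nat) : Prop :=
  [/\ forall s, m s s = 1%N,
      forall s t, m s t = m t s &
      has_presentation (fun s : S => val s)
        (fun w => exists s t, w = coxeter_relator m s t)].

Definition even_system (m : S -> S -> nat) : Prop :=
  forall s t, s != t -> ~~ odd (m s t).

Definition word_val (w : seq S) : G := \prod_(s <- w) val s.

(* Inverses of generators are not needed as letters, since the generators of a
   Coxeter system are involutions.  The default value 0 only concerns elements
   outside the submonoid generated by S. *)
Definition word_length (g : G) : nat :=
  if pselect (exists n, [exists w : n.-tuple S, word_val w == g]) is left h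
  then ex_minn h else 0%N.

Definition geodesic_growth (r : nat) : nat :=
  #|[set w : r.-tuple S | word_length (word_val w) == r]|.

End Coxeter.

(* Finite simplicial graph with labelled edges; elab is only meaningful on
   adjacent pairs. *)
Record lgraph := LGraph {
  vertex : finType;
  adj : rel vertex;
  elab : vertex -> vertex -> nat;
  adj_irr : irreflexive adj;
  adj_sym : symmetric adj;
  elab_sym : forall x y, adj x y -> elab x y = elab y x
}.

Definition lgraph_iso (A B : lgraph) : Prop :=
  exists f : vertex A -> vertex B,
    [/\ bijective f,
        forall x y, adj (f x) (f y) = adj x y &
        forall x y, adj x y -> elab (f x) (f y) = elab x y].

Section Star.
Variables (A : lgraph) (v : vertex A).

Definition star_vertex : finType := {x : vertex A | (x == v) || adj v x}.
Definition star_adj : rel star_vertex := fun x y => adj (val x) (val y).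
Definition star_elab (x y : star_vertex) : nat := elab (val x) (val y).

Fact star_adj_irr : irreflexive star_adj.
Proof. by move=> x; apply: adj_irr. Qed.

Fact star_adj_sym : symmetric star_adj.
Proof. by move=> x y; apply: adj_sym. Qed.

Fact star_elab_sym x y : star_adj x y -> star_elab x y = star_elab y x.
Proof. exact: elab_sym. Qed.

Definition star : lgraph := LGraph star_adj_irr star_adj_sym star_elab_sym.

End Star.

Definition triangle_free (A : lgraph) : Prop :=
  forall x y z : vertex A, ~~ [&& adj x y, adj y z & adj x z].

Definition star_regular (A : lgraph) : Prop :=
  forall u v : vertex A, lgraph_iso (star u) (star v).

Section CoxeterGraph.
Variables (G : groupType) (S : {fset G}) (m : S -> S -> nat).
Hypothesis cox : coxeter_system m.

Definition coxeter_adj : rel S := fun s t => (s != t) && (m s t != 0%N).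

Fact coxeter_adj_irr : irreflexive coxeter_adj.
Proof. by move=> s; rewrite /coxeter_adj eqxx. Qed.

Fact coxeter_adj_sym : symmetric coxeter_adj.
Proof. by case: cox => _ mC _ s t; rewrite /coxeter_adj eq_sym mC. Qed.

Fact coxeter_elab_sym s t : coxeter_adj s t -> m s t = m t s.
Proof. by case: cox => _ mC _ _; apply: mC. Qed.

Definition coxeter_graph : lgraph :=
  LGraph coxeter_adj_irr coxeter_adj_sym coxeter_elab_sym.

End CoxeterGraph.

(* Main.v *)
Require Import Defs.
From mathcomp Require Import all_boot finmap boolp.
From mathcomp Require Import ssralg ssrint intdiv zify.

(** Write l(g) for the word length and call s a descent of g if l(g s) < l(g).
    A word is geodesic exactly when each new letter is not a descent of the
    element read so far, so the growth is obtained by counting, from each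
    element g, the continuations that never meet a descent.  The point is that
    this count depends on very little of g.

    If s and t are distinct descents of g, then m s t is nonzero and g
    has a geodesic ending in the alternating word of length m s t on s and t, with
    either letter last ([two_descents]).  Hence the descents of g are pairwise
    adjacent, and without triangles there are at most two of them.  When a letter
    u is appended to g, another generator t becomes a descent only if it is a
    neighbour of u and g already ends in an alternating word of length m u t - 1
    on t and u ([new_descent]).  So one only has to remember how long an
    alternating suffix is, and on which edge; the absence of triangles ensures
    that at most one edge has a suffix of length two or more that matters for the
    future.  This leaves finitely many kinds of elements ([cone_type]): those
    whose last letter starts from scratch, those with an alternating suffix of
    length k < l on an edge labelled l, and those that end in a full alternating
    word of length l.  From each kind, the number of letters leading to each
    other kind is given by |S|, the degree and the labels around one vertex; two
    adjacent vertices have disjoint neighbourhoods, which settles the full case.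
    The resulting recursion ([cone_growth], [extensions_cone]) mentions the
    graph only through sums over the labels at a vertex, that is, through a star.

    The group theory rests on the reflections p s p^-1 read off the prefixes p s
    of a word.  The parity of the number of occurrences of a given reflection
    depends only on the value of the word, because it is even for every relator.
    This yields the exchange and deletion conditions, and, applied to a shortest
    representative of a coset of the subgroup generated by s and t, the statement
    on two descents.  That the alternating words involved really have length m s t
    needs the order of s t to be exactly m s t: as the system is even, sending all
    other generators to the identity is compatible with the relators, so that G
    acts on the integers modulo m s t with s and t acting as x |-> - x and
    x |-> 1 - x ([alternating_eq]). *)

Set Implicit Arguments.
Unset Strict Implicit.
Unset Printing Implicit Defensive.

Import GRing.Theory.

(** * The recursion for geodesic continuations *)

(** The geodesic continuations of length r of an element of a system with n
    generators that ends in an alternating word of length k on an edge labelled l;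
    k <= 1 encodes an element whose last letter prolongs no alternating word.
    The functional nbr_sum takes f to the sum of the values of f at the labels
    around a vertex, so that nbr_sum (fun=> 1) is the degree.  The next letter
    may be far from the last one (and starts afresh), adjacent to it (and starts
    an alternating word of length 2), or prolong the current one.  When k = l the
    last letter may be taken to be either end of the edge: both are descents, and
    the neighbourhoods of both contribute, except for the edge itself. *)
Fixpoint cone_growth (n : nat) (nbr_sum : (nat -> nat) -> nat) (r k l : nat) : nat :=
  if r is r'.+1 then
    let c := cone_growth n nbr_sum r' in
    let d := nbr_sum (fun=> 1) in
    if k <= 1 then (n - 1 - d) * c 1 0 + nbr_sum (c 2)
    else if k < l then
      (n - 1 - d) * c 1 0 + (nbr_sum (c 2) - c 2 l) + c k.+1 l
    else (n - 2 * d) * c 1 0 + 2 * (nbr_sum (c 2) - c 2 l)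
  else 1.

(** * Words, reflections and length *)

Section CoxeterWords.
Local Open Scope group_scope.
Variables (G : groupType) (S : {fset G}) (m : S -> S -> nat).
Hypothesis cox : coxeter_system m.
Implicit Types (g h : G) (s t u : S) (w p q : seq S).

Let m_diag s : m s s = 1%N. Proof. by case: cox. Qed.
Let m_sym s t : m s t = m t s. Proof. by case: cox. Qed.

Lemma word_val_nil : word_val ([::] : seq S) = 1 :> G.
Proof. by rewrite /word_val big_nil. Qed.

Lemma word_val_cons s w : word_val (s :: w) = val s * word_val w.
Proof. by rewrite /word_val big_cons. Qed.

Lemma word_val_cat w p : word_val (w ++ p) = word_val w * word_val p.
Proof. by rewrite /word_val big_cat. Qed.

Lemma word_val_rcons w s : word_val (rcons w s) = word_val w * val s.
Proof. by rewrite -cats1 word_val_cat word_val_cons word_val_nil mulg1. Qed.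

Definition relator_word s t : seq S := flatten (nseq (m s t) [:: s; t]).

Lemma word_val_power k s t :
  word_val (flatten (nseq k [:: s; t])) = (val s * val t) ^+ k.
Proof.
elim: k => [|k IH]; first exact: word_val_nil.
by rewrite /= !word_val_cons IH expgS !mulgA.
Qed.

Let pos w : gword S := [seq (s, true) | s <- w].

Let gword_val_pos w : gword_val (fun s : S => val s) (pos w) = word_val w.
Proof. by rewrite /gword_val /word_val big_map. Qed.

Lemma relator_val s t : word_val (relator_word s t) = 1.
Proof.
have [_ _ [_ /(_ (coxeter_relator m s t) [::]) [_ H]]] := cox.
have {}H : gword_val (fun s : S => val s) (coxeter_relator m s t)
           = gword_val (fun s : S => val s) [::].
  apply: H; rewrite -[coxeter_relator m s t]cats0.
  by apply: (@PresRelator _ _ [::] [::]); exists s, t.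
rewrite -gword_val_pos.
have -> : pos (relator_word s t) = coxeter_relator m s t.
  by rewrite /pos map_flatten map_nseq.
by rewrite H /gword_val big_nil.
Qed.

Lemma generator_power s t : (val s * val t) ^+ m s t = 1.
Proof. by rewrite -word_val_power; exact: relator_val. Qed.

Lemma generator_sq s : val s * val s = 1.
Proof. by have := generator_power s s; rewrite m_diag expg1. Qed.

Lemma generatorV s : (val s)^-1 = val s.
Proof. exact/mulg1_eq/generator_sq. Qed.

Lemma generatorK s g : g * val s * val s = g.
Proof. by rewrite -mulgA generator_sq mulg1. Qed.

Lemma generatorKl s g : val s * (val s * g) = g.
Proof. by rewrite mulgA generator_sq mul1g. Qed.

Lemma word_val_rev w : word_val (rev w) = (word_val w)^-1.
Proof.
elim: w => [|s w IH]; first by rewrite word_val_nil invg1.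
by rewrite rev_cons word_val_rcons word_val_cons invgM IH generatorV.
Qed.

(** Generators are involutions, so formal inverses may be read as generators. *)
Let gword_valE (x : gword S) :
  gword_val (fun s : S => val s) x = word_val (map fst x).
Proof.
rewrite /gword_val /word_val big_map; apply: eq_bigr => -[s b] _ /=.
by case: b => //; rewrite generatorV.
Qed.

Lemma word_val_surj g : exists w : seq S, word_val w = g.
Proof.
have [_ _ [/(_ g) [x <-] _]] := cox.
by exists (map fst x); rewrite gword_valE.
Qed.

(** The defining property of a presentation, for words without inverses: an
    equivalence that ignores relators inside a word contains equality of values.
    Since m s s = 1, deleting s s is a case of deleting a relator. *)
Lemma word_congruence (E : seq S -> seq S -> Prop) :
    (forall w, E w w) -> (forall w p, E w p -> E p w) ->
    (forall w p q, E w p -> E p q -> E w q) ->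
    (forall w p s t, E (w ++ relator_word s t ++ p) (w ++ p)) ->
  forall w p, word_val w = word_val p -> E w p.
Proof.
move=> Erefl Esym Etrans Erel w p; have [_ _ [_ /(_ (pos w) (pos p)) [H _]]] := cox.
rewrite !gword_val_pos in H => /H {H} H.
suff: E (map fst (pos w)) (map fst (pos p)).
  by rewrite -!map_comp !map_id.
elim: H => {w p} [w|w p _|w p q _ + _|w p s b|w p r [s [t ->]]] //.
- exact: Esym.
- exact: Etrans.
- rewrite !map_cat /=; have := Erel (map fst w) (map fst p) s s.
  by rewrite /relator_word m_diag.
- rewrite !map_cat; have := Erel (map fst w) (map fst p) s t.
  by rewrite /relator_word /coxeter_relator map_flatten map_nseq.
Qed.

Lemma size_relator s t : size (relator_word s t) = (m s t).*2.
Proof. by rewrite size_flatten /shape map_nseq sumn_nseq /= mul2n. Qed.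

Lemma word_val_odd w p : word_val w = word_val p -> odd (size w) = odd (size p).
Proof.
apply: (@word_congruence (fun w p => odd (size w) = odd (size p))) => //.
  by move=> ? ? ? ->.
by move=> {}w {}p s t; rewrite !size_cat size_relator !oddD odd_double addFb.
Qed.

(** The elements p s p^-1 for the prefixes p s of the word. *)
Fixpoint reflections w : seq G :=
  if w is s :: w' then val s :: [seq r ^ val s | r <- reflections w'] else [::].

Lemma size_reflections w : size (reflections w) = size w.
Proof. by elim: w => //= s w <-; rewrite size_map. Qed.

Lemma reflections_cat w p :
  reflections (w ++ p)
  = reflections w ++ [seq r ^ (word_val w)^-1 | r <- reflections p].
Proof.
elim: w => [|s w IH] /=.
  rewrite word_val_nil invg1; under eq_map do rewrite conjg1.
  by rewrite map_id.
rewrite IH map_cat -map_comp; congr (_ :: _ ++ _); apply: eq_map => r /=.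
by rewrite word_val_cons invgM generatorV conjgM.
Qed.

(** The powers of s t spread these reflections with period m s t, half the length
    of the relator; this makes each of them occur an even number of times. *)
Lemma reflections_power k s t :
  reflections (flatten (nseq k [:: s; t]))
  = [seq (val s * val t) ^+ i * val s | i <- iota 0 (k + k)].
Proof.
elim: k => [//|k IH]; rewrite addnS addSn.
rewrite -[flatten _]/([:: s; t] ++ flatten (nseq k [:: s; t])).
rewrite reflections_cat IH /= expg0 mul1g expg1.
rewrite conjgE generatorV !mulgA; congr [:: _, _ & _].
rewrite (iotaDl 2 0) -!map_comp; apply: eq_map => i /=.
rewrite !word_val_cons word_val_nil mulg1 conjgE invgK invgM !generatorV.
by rewrite expgS expgSr !mulgA.
Qed.

(** Relators contribute every reflection an even number of times, since their
    reflections are listed twice over, and have value 1, so the reflections of the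
    letters after them are unchanged. *)
Lemma word_val_reflections w p r :
    word_val w = word_val p ->
  odd (count_mem r (reflections w)) = odd (count_mem r (reflections p)).
Proof.
pose par w := odd (count_mem r (reflections w)).
apply: (@word_congruence (fun w p => par w = par p)) => //.
  by move=> ? ? ? ->.
move=> {}w {}p s t; rewrite /par !reflections_cat relator_val invg1.
have -> : [seq x ^ 1 | x <- reflections p] = reflections p.
  by rewrite -[RHS]map_id; apply: eq_map => x; rewrite conjg1.
rewrite map_cat !count_cat !oddD; set x := odd (count _ (map _ _)).
suff -> : x = false by rewrite addFb.
(* The i-th and the (i + m s t)-th reflections of a relator coincide. *)
rewrite /x /relator_word reflections_power iotaD add0n !map_cat count_cat.
have -> : iota (m s t) (m s t) = map (addn (m s t)) (iota 0 (m s t)).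
  by rewrite -iotaDl addn0.
rewrite -!map_comp oddD.
set y := count _ _; set z := count _ _; suff -> : z = y by rewrite addbb.
by congr (count _ _); apply: eq_map => i /=; rewrite expgnDr generator_power mul1g.
Qed.

(** If r = p s p^-1 with p s a prefix of w, multiplying w by r on the left cancels
    that letter s. *)
Lemma exchange w r :
  r \in reflections w ->
  exists p, [/\ subseq p w, size p < size w & word_val p = r * word_val w].
Proof.
elim: w r => [//|s w IH] r /=; rewrite in_cons => /predU1P [->|].
  exists w; split; [exact: subseq_cons| by [] | by rewrite word_val_cons generatorKl].
case/mapP => x /IH [p [sub_p lt_p val_p]] ->.
exists (s :: p); split=> //=; first by rewrite eqxx.
by rewrite !word_val_cons val_p conjgE generatorV !mulgA generatorK.
Qed.

Lemma deletion w :
  ~~ uniq (reflections w) ->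
  exists p, [/\ subseq p w, size p < size w & word_val p = word_val w].
Proof.
elim: w => [//|s w IH] /=; rewrite negb_and => /orP[].
  rewrite negbK => /mapP [r /exchange [p [sub_p lt_p val_p]] def_s].
  exists p; split.
  - exact: subseq_trans sub_p (subseq_cons _ _).
  - exact: ltnW.
  rewrite val_p word_val_cons; congr (_ * _).
  by apply: (@conjg_inj _ (val s)); rewrite -def_s conjgE mulKg.
rewrite map_inj_uniq; last exact: conjg_inj.
move=> /IH [p [sub_p lt_p val_p]]; exists (s :: p); split=> //=.
  by rewrite eqxx.
by rewrite !word_val_cons val_p.
Qed.

(** A reflection that occurs once in w occurs an odd number of times, hence at
    least once, in every other word with the same value. *)
Lemma uniq_reflections_size w p :
  uniq (reflections w) -> word_val w = word_val p -> size w <= size p.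
Proof.
move=> uniq_w val_wp; rewrite -size_reflections -(size_reflections p).
apply: uniq_leq_size => // r r_w; rewrite -has_pred1 has_count.
have := word_val_reflections r val_wp; rewrite count_uniq_mem // r_w /=.
by case: count.
Qed.

Lemma reduced_subword w :
  exists p, [/\ subseq p w, uniq (reflections p) & word_val p = word_val w].
Proof.
have [n] := ubnP (size w); elim: n w => // n IH w; rewrite ltnS => le_w.
have [uniq_w|/deletion [p [sub_p lt_p val_p]]] := boolP (uniq (reflections w)).
  by exists w.
have [q [sub_q uniq_q val_q]] := IH p (leq_trans lt_p le_w).
exists q; split=> //; last by rewrite val_q.
exact: subseq_trans sub_q sub_p.
Qed.

Lemma word_length_le w : word_length S (word_val w) <= size w.
Proof.
rewrite /word_length; case: pselect => [ex|[]]; last first.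
  by exists (size w); apply/existsP; exists (in_tuple w).
by case: ex_minnP => n _; apply; apply/existsP; exists (in_tuple w).
Qed.

Lemma word_length_witness g :
  exists2 w : seq S, word_val w = g & size w = word_length S g.
Proof.
rewrite /word_length; case: pselect => [ex|[]]; last first.
  have [w val_w] := word_val_surj g; exists (size w).
  by apply/existsP; exists (in_tuple w); apply/eqP.
case: ex_minnP => n /existsP [w /eqP val_w] _; exists (tval w) => //.
exact: size_tuple.
Qed.

Lemma word_length_uniq w :
  uniq (reflections w) = (word_length S (word_val w) == size w).
Proof.
have [p val_p size_p] := word_length_witness (word_val w).
apply/idP/eqP => [uniq_w|len_w].
  apply/eqP; rewrite eqn_leq word_length_le -size_p.
  exact: uniq_reflections_size.
apply/negPn/negP => /deletion [q [_ lt_q val_q]].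
by have := word_length_le q; rewrite val_q len_w leqNgt lt_q.
Qed.

Lemma word_length1 : word_length S 1 = 0%N.
Proof. by apply/eqP; have := word_length_le [::]; rewrite word_val_nil leqn0. Qed.

Lemma word_length_mul g w : word_length S (g * word_val w) <= word_length S g + size w.
Proof.
have [p <- <-] := word_length_witness g.
by rewrite -word_val_cat -size_cat word_length_le.
Qed.

Lemma word_length_odd g s :
  odd (word_length S (g * val s)) = ~~ odd (word_length S g).
Proof.
have [p val_p <-] := word_length_witness g.
have [q val_q <-] := word_length_witness (g * val s).
have := @word_val_odd q (rcons p s); rewrite word_val_rcons val_p val_q.
by rewrite size_rcons; apply.
Qed.

Definition descent g s := word_length S (g * val s) < word_length S g.

Lemma word_length_mul1 g s : word_length S (g * val s) <= (word_length S g).+1.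
Proof.
by have := word_length_mul g [:: s]; rewrite word_val_cons word_val_nil mulg1 addn1.
Qed.

Lemma word_length_ascent g s :
  ~~ descent g s -> word_length S (g * val s) = (word_length S g).+1.
Proof.
rewrite /descent; have := word_length_odd g s; have := word_length_mul1 g s.
lia.
Qed.

Lemma word_length_descent g s :
  descent g s -> word_length S g = (word_length S (g * val s)).+1.
Proof.
rewrite /descent; have := word_length_mul1 (g * val s) s; rewrite generatorK.
lia.
Qed.

Lemma descent_mul g s : descent (g * val s) s = ~~ descent g s.
Proof.
rewrite {1}/descent generatorK /descent; have := word_length_odd g s.
lia.
Qed.

(** * Alternating words and the dihedral action *)

(** Indexed by the last letter s, because descents see suffixes. *)
Fixpoint alternating j s t : seq S :=
  if j is j'.+1 then rcons (alternating j' t s) s else [::].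

Lemma size_alternating j s t : size (alternating j s t) = j.
Proof. by elim: j s t => //= j IH s t; rewrite size_rcons IH. Qed.

(** The letters s and t act as two reflections of the integer line whose product
    is a translation by one; modulo m s t this is the dihedral quotient of G in
    which the other generators become trivial. *)
Definition reflect_line s t u (x : int) : int :=
  if u == s then (- x)%R else if u == t then (1 - x)%R else x.

Definition line_action s t w (x : int) : int := foldr (reflect_line s t) x w.

Lemma line_action_alternating s t (x : int) j : s != t ->
  (line_action s t (alternating j s t) x = (-1) ^+ j * (x + j./2%:Z) /\
   line_action s t (alternating j t s) x = (-1) ^+ j * (x - (uphalf j)%:Z))%R.
Proof.
move=> neq_st; elim: j x => [|j IH] x /=; first by split; lia.
rewrite /line_action !foldr_rcons -!/(line_action _ _ _ _).
rewrite /reflect_line eqxx (eq_sym t s) (negPf neq_st) eqxx.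
rewrite !(proj1 (IH _)) !(proj2 (IH _)) !GRing.exprS.
by split; rewrite GRing.mulN1r GRing.mulNr -GRing.mulrN; congr (_ * _)%R; lia.
Qed.

Let dvdz_opp (d x : int) : (d %| (- x)%R)%Z = (d %| x)%Z.
Proof. by rewrite !dvdzE abszN. Qed.

Lemma dvdz_line_action s t w (x y d : int) :
  (d %| (x - y)%R)%Z -> (d %| (line_action s t w x - line_action s t w y)%R)%Z.
Proof.
elim: w => //= u w IH /IH {}IH; rewrite /reflect_line.
have swap (a b : int) : (a - b = - (b - a))%R by lia.
case: eqP => _; last case: eqP => _ //; rewrite -dvdz_opp.
  by rewrite (_ : (- _)%R = (line_action s t w x - line_action s t w y)%R) //; lia.
by rewrite (_ : (- _)%R = (line_action s t w x - line_action s t w y)%R) //; lia.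
Qed.

Lemma reflect_lineK s t u : involutive (reflect_line s t u).
Proof. by move=> x; rewrite /reflect_line; case: (u == s); last case: (u == t); lia. Qed.

Lemma line_action_power s t a b k (x : int) :
  line_action s t (flatten (nseq k [:: a; b])) x
  = iter k (fun y => reflect_line s t a (reflect_line s t b y)) x.
Proof. by elim: k => //= k ->. Qed.

Hypothesis m_even : even_system m.

(** A relator on s and t translates by m s t.  In any other relator on two distinct
    letters at least one of them acts trivially, so that their product acts as an
    involution, and its exponent is even. *)
Lemma line_action_relator s t a b (x : int) : s != t ->
  (m s t %| (line_action s t (relator_word a b) x - x)%R)%Z.
Proof.
move=> neq_st; rewrite line_action_power.
have [<-|neq_ab] := eqVneq a b; first by rewrite m_diag /= reflect_lineK subrr.
set f := fun _ => _.
have inv_case : involutive f -> (m s t %| (iter (m a b) f x - x)%R)%Z.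
  move=> fK; suff -> : iter (m a b) f x = x by rewrite subrr.
  rewrite -[m a b]even_halfK ?m_even // -mul2n mulnC iterM.
  by elim: (_./2) => //= k ->; rewrite fK.
have [eq_as|neq_as] := eqVneq a s; last have [eq_at|neq_at] := eqVneq a t.
- have [eq_bt|neq_bt] := eqVneq b t; last first.
    apply: inv_case => y; rewrite /f {2 4}/reflect_line -eq_as eq_sym (negPf neq_ab).
    by rewrite (negPf neq_bt) reflect_lineK.
  rewrite eq_as eq_bt; suff -> : iter (m s t) f x = (x - (m s t)%:Z)%R.
    by rewrite addrAC subrr add0r dvdz_opp.
  elim: (m s t) => [|k IH] /=; first by lia.
  by rewrite IH /f eq_as eq_bt /reflect_line eqxx eq_sym (negPf neq_st) eqxx; lia.
- have [eq_bs|neq_bs] := eqVneq b s; last first.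
    apply: inv_case => y; rewrite /f {2 4}/reflect_line -eq_at [b == a]eq_sym.
    by rewrite (negPf neq_ab) (negPf neq_bs) reflect_lineK.
  rewrite eq_at eq_bs m_sym; suff -> : iter (m s t) f x = (x + (m s t)%:Z)%R.
    by rewrite addrAC subrr add0r.
  elim: (m s t) => [|k IH] /=; first by lia.
  by rewrite IH /f eq_at eq_bs /reflect_line eqxx eq_sym (negPf neq_st) eqxx; lia.
- apply: inv_case => y; rewrite /f /reflect_line !(negPf neq_as) !(negPf neq_at).
  exact: reflect_lineK.
Qed.

Lemma word_val_line_action s t w p (x : int) : s != t -> word_val w = word_val p ->
  (m s t %| (line_action s t w x - line_action s t p x)%R)%Z.
Proof.
move=> neq_st eq_wp; move: x.
apply: (@word_congruence
  (fun w p => forall x, (m s t %| (line_action s t w x - line_action s t p x)%R)%Z)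
  _ _ _ _ w p eq_wp) => {w p eq_wp}.
- by move=> w x; rewrite subrr.
- by move=> w p dvd_wp x; rewrite -dvdz_opp opprB.
- move=> w p q dvd_wp dvd_pq x.
  by have := rpredD (dvd_wp x) (dvd_pq x); rewrite addrA addrNK.
- move=> w p a b x; rewrite /line_action !foldr_cat; apply: dvdz_line_action.
  exact: line_action_relator.
Qed.

(** Two alternating words of length j with different last letters move the
    points of the line to images at distance j, so j is a multiple of m s t. *)
Lemma alternating_eq j s t : s != t -> 0 < j ->
    word_val (alternating j s t) = word_val (alternating j t s) ->
  m s t != 0%N /\ m s t <= j.
Proof.
move=> neq_st j_gt0 /(word_val_line_action 0 neq_st).
rewrite !(proj1 (line_action_alternating _ _ neq_st)).
rewrite !(proj2 (line_action_alternating _ _ neq_st)) -mulrBr.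
rewrite (_ : _ - _ = j :> int)%R; last first.
  by rewrite uphalf_half; have := odd_double_half j; lia.
rewrite dvdzE abszMsign => dvd_mj.
split; last exact: dvdn_leq.
by apply: contraTneq dvd_mj => ->; rewrite dvd0n -lt0n.
Qed.

(** * Alternating suffixes and descents *)

(** Whether some geodesic for g ends in the alternating word of length j on s and t
    with last letter s; testing descents one by one keeps this decidable. *)
Fixpoint alternating_descent j g s t : bool :=
  if j is j'.+1 then descent g s && alternating_descent j' (g * val s) t s else true.
Local Notation desc := alternating_descent.

Lemma desc_le i j g s t : i <= j -> desc j g s t -> desc i g s t.
Proof.
elim: j i g s t => [|j IH] [|i] g s t //= le_ij /andP [-> ]; exact: IH.
Qed.

Lemma desc_length j g s t : desc j g s t ->
  exists2 h, g = h * word_val (alternating j s t)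
           & word_length S g = (word_length S h + j)%N.
Proof.
elim: j g s t => [|j IH] g s t /=.
  by exists g; rewrite ?word_val_nil ?mulg1 ?addn0.
case/andP => /word_length_descent -> /IH [h def_g ->]; exists h; last by rewrite addnS.
by rewrite word_val_rcons mulgA -def_g generatorK.
Qed.

Lemma length_desc j h s t :
    word_length S (h * word_val (alternating j s t)) = (word_length S h + j)%N ->
  desc j (h * word_val (alternating j s t)) s t.
Proof.
elim: j s t => //= j IH s t; rewrite word_val_rcons mulgA.
set g := h * word_val _ => len_gs.
have le_g : word_length S g <= word_length S h + j.
  by rewrite -(size_alternating j t s) word_length_mul.
have := word_length_mul1 g s; rewrite len_gs addnS ltnS => ge_g.
have len_g : word_length S g = (word_length S h + j)%N by apply/eqP; rewrite eqn_leq le_g.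
by rewrite /descent generatorK len_gs len_g addnS leqnn IH.
Qed.

Lemma desc_ascent g s t j : ~~ descent g s -> desc j.+1 (g * val s) s t = desc j g t s.
Proof. by move=> asc; rewrite /= descent_mul asc generatorK. Qed.

Lemma alternating_val_double i s t :
  word_val (alternating i.*2 s t) = (val t * val s) ^+ i.
Proof.
elim: i => [|i IH]; first exact: word_val_nil.
by rewrite doubleS /= !word_val_rcons IH expgSr mulgA.
Qed.

Lemma braid_relation s t : s != t ->
  word_val (alternating (m s t) s t) = word_val (alternating (m s t) t s).
Proof.
move=> neq_st; rewrite -[m s t]even_halfK ?m_even // !alternating_val_double.
apply/eqP; rewrite -[val t * val s]invgK invgM !generatorV expVgn eq_sym -mulg_eq1.
by rewrite -expgnDr addnn even_halfK ?m_even // generator_power.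
Qed.

(** The braid relation replaces the alternating suffix ending in s by the one
    ending in t. *)
Lemma desc_full g s t :
  s != t -> m s t != 0%N -> desc (m s t) g s t -> descent g t.
Proof.
move=> neq_st m_neq0 /desc_length [h ->]; rewrite braid_relation // /descent => ->.
case: (m s t) m_neq0 => // j _ /=; rewrite word_val_rcons mulgA generatorK.
by rewrite addnS ltnS -{2}(size_alternating j s t) word_length_mul.
Qed.

(** By descent on the length: as long as some q over P shortens g, pass to g q. *)
Lemma coset_minimal (P : pred S) g :
  exists h p, [/\ all P p, g = h * word_val p &
    forall q, all P q -> word_length S h <= word_length S (h * word_val q)].
Proof.
have [n] := ubnP (word_length S g); elim: n g => // n IH g; rewrite ltnS => le_g.
have [[q P_q lt_q]|no_q] := pselect (exists2 q, all P q &
    word_length S (g * word_val q) < word_length S g).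
  have [h [p [P_p def_g min_h]]] := IH _ (leq_trans lt_q le_g).
  exists h, (p ++ rev q); split => //; first by rewrite all_cat P_p all_rev.
  by rewrite word_val_cat mulgA -def_g word_val_rev mulgK.
exists g, [::]; split=> // [|q P_q]; first by rewrite word_val_nil mulg1.
by rewrite leqNgt; apply/negP => lt_q; case: no_q; exists q.
Qed.

Lemma reflections_parabolic (P : pred S) p r :
  all P p -> r \in reflections p -> exists2 q, all P q & word_val q = r.
Proof.
elim: p r => [//|s p IH] r /= /andP [P_s P_p]; rewrite in_cons => /predU1P [->|].
  by exists [:: s]; rewrite /= ?P_s // word_val_cons word_val_nil mulg1.
case/mapP => x /(IH _ P_p) [q P_q <-] ->; exists (s :: rcons q s).
  by rewrite /= all_rcons P_s.
by rewrite word_val_cons word_val_rcons conjgE generatorV.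
Qed.

(** If a geodesic for h followed by p were not reduced, some reflection of p,
    conjugated by h, would be a reflection of h; exchanging it would shorten h by
    right multiplication by a word over P, against the choice of h. *)
Lemma coset_length (P : pred S) h p :
    (forall q, all P q -> word_length S h <= word_length S (h * word_val q)) ->
    all P p -> uniq (reflections p) ->
  word_length S (h * word_val p) = (word_length S h + size p)%N.
Proof.
move=> min_h P_p uniq_p; have [w val_w size_w] := word_length_witness h.
rewrite -val_w -word_val_cat val_w -size_w -size_cat; apply/eqP.
rewrite -word_length_uniq reflections_cat cat_uniq word_length_uniq val_w size_w eqxx.
rewrite map_inj_uniq ?uniq_p; last exact: conjg_inj.
rewrite andbT; apply/hasPn => _ /mapP [r r_p ->]; apply/negP.
case/exchange => q [_ lt_q val_q].
have [x P_x val_x] := reflections_parabolic P_p r_p.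
have := min_h x P_x; rewrite leqNgt => /negP []; rewrite -size_w.
apply: leq_ltn_trans lt_q; rewrite -[h * _](_ : word_val q = _) ?word_length_le //.
by rewrite val_q val_w conjgE invgK val_x -!mulgA mulVg mulg1.
Qed.

Lemma reduced_alternating s t q :
    all (pred2 s t) q -> uniq (reflections (rcons q t)) ->
  rcons q t = alternating (size q).+1 t s.
Proof.
elim/last_ind: q s t => // q b IH s t; rewrite all_rcons => /andP [b_st q_st] uniq_q.
have uniq_qb : uniq (reflections (rcons q b)).
  by move: uniq_q; rewrite -cats1 reflections_cat cat_uniq => /andP [].
have neq_bt : b != t.
  apply: contraTneq uniq_q => def_b; rewrite def_b word_length_uniq.
  rewrite !word_val_rcons generatorK neq_ltn !size_rcons.
  by rewrite (leq_ltn_trans (word_length_le q)).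
have def_b : b = s by move: b_st; rewrite /= (negPf neq_bt) orbF => /eqP.
rewrite def_b in uniq_qb *; rewrite /= size_rcons -IH //.
by apply: sub_all q_st => x /=; rewrite orbC.
Qed.

(** Write g = h p with h shortest modulo the subgroup generated by s and t.  Lengths
    add up, so s and t are both descents of p, which therefore equals both
    alternating words of its length; the dihedral action bounds this length from
    below by m s t. *)
Lemma two_descents g s t : s != t -> descent g s -> descent g t ->
  m s t != 0%N /\ desc (m s t) g s t.
Proof.
move=> neq_st desc_s desc_t.
have [h [p0 [P_p0 def_g min_h]]] := coset_minimal (pred2 s t) g.
have [p [sub_p uniq_p val_p]] := reduced_subword p0.
have P_p : all (pred2 s t) p by apply/allP => x /(mem_subseq sub_p); exact/allP.
rewrite -val_p in def_g.
have len_g : word_length S g = (word_length S h + size p)%N.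
  by rewrite def_g (coset_length min_h).
have ends_in a b : perm_eq [:: a; b] [:: s; t] -> descent g a ->
    0 < size p /\ word_val p = word_val (alternating (size p) a b).
  move=> perm_ab desc_a.
  have P_ab : pred2 s t =1 pred2 b a.
    by move=> x; have := perm_mem perm_ab x; rewrite !inE orbC => <-.
  have P_pa : all (pred2 s t) (rcons p a) by rewrite all_rcons P_p P_ab /= eqxx orbT.
  have [q [sub_q uniq_q val_q]] := reduced_subword (rcons p a).
  have P_q : all (pred2 s t) q by apply/allP => x /(mem_subseq sub_q); exact/allP.
  move: desc_a; rewrite /descent len_g def_g -mulgA -word_val_rcons -val_q.
  rewrite (coset_length min_h) // ltn_add2l => lt_qp.
  have val_qa : word_val (rcons q a) = word_val p.
    by rewrite word_val_rcons val_q word_val_rcons generatorK.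
  have size_p : size p = (size q).+1.
    apply/eqP; rewrite eqn_leq lt_qp -(size_rcons q a) andbT.
    exact: uniq_reflections_size.
  split; first by rewrite size_p.
  rewrite size_p -(@reduced_alternating b a q) //; first by rewrite -(eq_all P_ab).
  by rewrite word_length_uniq val_qa size_rcons -size_p -word_length_uniq.
have [p_gt0 val_ps] := ends_in s t (perm_refl _) desc_s.
have [_ val_pt] := ends_in t s (introT permPl (perm_catC [:: t] [:: s])) desc_t.
have [m_neq0 le_m] := alternating_eq neq_st p_gt0 (etrans (esym val_ps) val_pt).
split=> //; apply: desc_le le_m _.
by rewrite def_g val_ps length_desc // -val_ps -def_g.
Qed.

(** * Cone types *)

Hypothesis tri_free : triangle_free (coxeter_graph cox).
Local Notation adj := (coxeter_adj m).

Lemma adj_label_gt1 s t : adj s t -> 1 < m s t.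
Proof. by case/andP => /m_even; case: (m s t) => [|[|]]. Qed.

Lemma no_triangle s t u : adj s t -> adj t u -> adj s u = false.
Proof.
move=> st tu; apply/negP => su; move: (tri_free s t u).
by rewrite /= st tu su.
Qed.

Lemma descents_adj g s t : descent g s -> descent g t -> s != t -> adj s t.
Proof. by move=> ds dt st; rewrite /coxeter_adj st; have [] := two_descents st ds dt. Qed.

(** The alternating suffix of g u on u and t is one letter longer than the one of g
    on t and u, and t is a descent once the full length m u t is reached. *)
Lemma new_descent g u t : ~~ descent g u -> t != u ->
  descent (g * val u) t = adj u t && desc (m u t).-1 g t u.
Proof.
move=> asc_u; rewrite eq_sym => neq_ut.
have desc_u : descent (g * val u) u by rewrite descent_mul.
apply/idP/andP => [desc_t|[adj_ut]].
  have := descents_adj desc_u desc_t neq_ut => adj_ut.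
  have [_] := two_descents neq_ut desc_u desc_t.
  by rewrite -[m u t]prednK ?desc_ascent // (ltnW (adj_label_gt1 adj_ut)).
have := adj_label_gt1 adj_ut; move/ltnW/prednK => m_eq desc_gt.
case/andP: adj_ut => _ m_neq0; apply: desc_full neq_ut m_neq0 _.
by rewrite -m_eq desc_ascent.
Qed.

(** A suffix of length m u s would make u a descent. *)
Lemma desc_lt_label g s u k :
  ~~ descent g u -> adj u s -> desc k g s u -> k < m u s.
Proof.
move=> asc_u adj_us desc_k; rewrite ltnNge; apply: contra asc_u => le_mk.
case/andP: adj_us => neq_us m_neq0; apply: (@desc_full g s u).
- by rewrite eq_sym.
- by rewrite m_sym.
- by apply: desc_le desc_k; rewrite m_sym.
Qed.

(** If g had an alternating suffix of length 2 on s and u, both t and u would be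
    descents of g s, and s, t, u would form a triangle. *)
Lemma full_fresh g s t u :
  descent g s -> descent g t -> s != t -> adj s u -> u != t -> ~~ desc 2 g s u.
Proof.
move=> ds dt neq_st adj_su neq_ut; rewrite /= ds andbT /=; apply/negP => du.
have adj_st := descents_adj ds dt neq_st.
have dt' : descent (g * val s) t.
  have [_] := two_descents neq_st ds dt.
  by move/(desc_le (adj_label_gt1 adj_st)) => /and3P [].
have adj_tu : adj t u by apply: descents_adj dt' du _; rewrite eq_sym.
by rewrite (no_triangle adj_st adj_tu) in adj_su.
Qed.

(** The state reached after a geodesic for g, in terms of its descents and of its
    alternating suffixes.  The parameters k and l are those of [cone_growth].  For
    full elements, [full_fresh] gives what the other two cases assume about the
    other neighbours. *)
Inductive cone_type g : nat -> nat -> Prop :=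
| Fresh s l of descent g =1 pred1 s
    & (forall x, adj s x -> ~~ desc 2 g s x) : cone_type g 1 l
| Alternating s t k of adj s t & 1 < k < m s t & descent g =1 pred1 s
    & desc k g s t & ~~ desc k.+1 g s t
    & (forall x, adj s x -> x != t -> ~~ desc 2 g s x) : cone_type g k (m s t)
| Full s t of adj s t & descent g =1 pred2 s t : cone_type g (m s t) (m s t).

Lemma ascent_fresh g u l : ~~ descent g u ->
  (forall x, adj u x -> ~~ descent g x) -> cone_type (g * val u) 1 l.
Proof.
move=> asc_u asc_nbr; apply: (@Fresh _ u) => [x|x adj_ux] /=.
  have [->|neq_xu] := eqVneq x u; first by rewrite descent_mul.
  rewrite new_descent //; apply/negP => /andP [adj_ux].
  case: (m u x) (adj_label_gt1 adj_ux) => [|[|j]] //= _ /andP [].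
  by rewrite (negPf (asc_nbr x _)).
by rewrite generatorK (negPf (asc_nbr x _)) // andbF.
Qed.

Lemma ascent_alternating g u s k : ~~ descent g u -> adj u s ->
    (forall x, adj u x -> descent g x = (x == s)) ->
    desc k.+1 g s u -> ~~ desc k.+2 g s u ->
  cone_type (g * val u) k.+2 (m u s).
Proof.
move=> asc_u adj_us nbr_u desc_k not_desc_k.
have lt_k := desc_lt_label asc_u adj_us desc_k.
have desc_new x : descent (g * val u) x
    = (x == u) || (x == s) && desc (m u s).-1 g s u.
  have [->|neq_xu] := eqVneq x u; first by rewrite descent_mul asc_u.
  rewrite new_descent //=; have [->|neq_xs] := eqVneq x s; first by rewrite adj_us.
  apply/negP => /andP [adj_ux].
  case: (m u x) (adj_label_gt1 adj_ux) => [|[|j]] //= _ /andP [].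
  by rewrite nbr_u // (negPf neq_xs).
have [eq_k|neq_k] := eqVneq k.+2 (m u s).
  rewrite eq_k; apply: Full => // x; rewrite desc_new -eq_k /=.
  by move: desc_k => /= ->; rewrite andbT.
apply: (@Alternating _ u s) => //.
- by apply/andP; split; rewrite // ltn_neqAle neq_k.
- move=> x; rewrite desc_new [X in _ && X](_ : _ = false) ?andbF ?orbF //.
  apply: contraNF not_desc_k; apply: desc_le.
  move: lt_k neq_k; lia.
- by rewrite desc_ascent.
- by rewrite desc_ascent.
move=> x adj_ux neq_xs; rewrite desc_ascent //= andbT.
by rewrite nbr_u.
Qed.

Fixpoint extensions n g : nat :=
  if n is n'.+1 then (\sum_(u | ~~ descent g u) extensions n' (g * val u))%N
  else 1%N.

(** If some letter fails to increase the length, the later letters cannot make up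
    for it, so geodesic continuations are built one non-descent at a time. *)
Lemma card_extensions n g :
  #|[set w : n.-tuple S | word_length S (g * word_val w) == (word_length S g + n)%N]|
  = extensions n g.
Proof.
elim: n g => [|n IH] g /=.
  rewrite -[RHS](@card_tuple 0 S); apply: eq_card => w.
  by rewrite !inE tuple0 word_val_nil mulg1 addn0 eqxx.
rewrite -sum1dep_card.
rewrite (reindex (fun x : S * n.-tuple S => [tuple of x.1 :: x.2])) /=; last first.
  exists (fun w : n.+1.-tuple S => (thead w, [tuple of behead w])) => [[u w] _|w _] /=.
    by congr pair; apply: val_inj.
  by rewrite [RHS]tuple_eta; apply: val_inj.
under eq_bigl do rewrite word_val_cons mulgA.
rewrite -(pair_big_dep xpredT (fun u (w : n.-tuple S) =>
   word_length S (g * val u * word_val w) == (word_length S g + n.+1)%N)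
   (fun _ _ => 1%N)) /=.
rewrite [RHS]big_mkcond; apply: eq_bigr => u _; case: ifPn => [asc_u|].
  by rewrite -IH sum1dep_card word_length_ascent // addSnnS.
rewrite negbK => desc_u; rewrite big_pred0 // => w.
apply/ltn_eqF/(leq_ltn_trans (word_length_mul (g * val u) w)).
by rewrite size_tuple (word_length_descent desc_u) addSnnS ltn_add2l.
Qed.

Lemma geodesic_growth_extensions n : geodesic_growth S n = extensions n 1.
Proof.
rewrite -card_extensions; apply: eq_card => w.
by rewrite !inE mul1g word_length1.
Qed.

(** * Counting continuations *)

Variable nbr_sum : (nat -> nat) -> nat.
Hypothesis nbr_sumE : forall s (f : nat -> nat),
  (\sum_(u | adj s u) f (m s u) = nbr_sum f)%N.
Let n := #|{: S}|.

Lemma nbr_sum_except s t (f : nat -> nat) : adj s t ->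
  (\sum_(u | adj s u && (u != t)) f (m s u) = nbr_sum f - f (m s t))%N.
Proof. by move=> adj_st; rewrite -(nbr_sumE s) [in RHS](bigD1 t) //= addKn. Qed.

Lemma card_non_nbr s :
  (\sum_(u | (u != s) && ~~ adj s u) 1 = n - 1 - nbr_sum (fun=> 1))%N.
Proof.
rewrite /n -sum1_card [in RHS](bigD1 s) //= addKn [in RHS](bigID (adj s)) /=.
rewrite -(nbr_sumE s) [X in (X + _ - _)%N](_ : _ = \sum_(u | adj s u) 1)%N ?addKn //.
by apply: eq_bigl => u; case: eqP => // ->; rewrite coxeter_adj_irr.
Qed.

(** The neighbourhoods of adjacent vertices are disjoint, and each of the two
    vertices lies in one of them. *)
Lemma card_non_nbr2 s t : adj s t ->
  (\sum_(u | ~~ adj s u && ~~ adj t u) 1 = n - 2 * nbr_sum (fun=> 1))%N.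
Proof.
move=> adj_st; have deg x := nbr_sumE x (fun=> 1%N).
rewrite /n -sum1_card [in RHS](bigID (adj s)) /= deg.
rewrite [in RHS](bigID (adj t)) /= mul2n -addnn subnDA addKn.
rewrite [X in (X + _ - _)%N](_ : _ = \sum_(u | adj t u) 1)%N.
  by rewrite deg addKn.
apply: eq_bigl => u; case: (boolP (adj t u)) => [adj_tu|]; last by rewrite andbF.
by rewrite (no_triangle adj_st adj_tu).
Qed.

(** For each cone type, the admissible letters are sorted by the cone type that they
    lead to. *)
Lemma extensions_cone k l r g :
  cone_type g k l -> extensions r g = cone_growth n nbr_sum r k l.
Proof.
elim: r k l g => // r IH k l g; set c := cone_growth n nbr_sum r.
have fresh g' u : ~~ descent g' u -> (forall x, adj u x -> ~~ descent g' x) ->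
    extensions r (g' * val u) = c 1%N 0%N.
  by move=> asc_u nbr_u; exact/IH/ascent_fresh.
(* A neighbour of a single descent starts an alternating word of length 2. *)
have paired g' u s : ~~ descent g' u -> adj s u ->
    (forall x, adj u x -> descent g' x = (x == s)) -> ~~ desc 2 g' s u ->
    extensions r (g' * val u) = c 2 (m s u).
  move=> asc_u adj_su nbr_u not_desc; rewrite m_sym; apply/IH.
  apply: ascent_alternating; rewrite 1?(coxeter_adj_sym cox) //=.
  by rewrite nbr_u // ?eqxx // (coxeter_adj_sym cox).
(* Letters far from all descents of g' all lead to the same cone type. *)
have sum_fresh g' (P : pred S) : (forall u, P u -> ~~ descent g' u) ->
    (forall u x, P u -> adj u x -> ~~ descent g' x) ->
    (\sum_(u | P u) extensions r (g' * val u) = (\sum_(u | P u) 1) * c 1 0)%N.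
  move=> asc_P nbr_P; rewrite big_distrl /=; apply: eq_bigr => u P_u.
  by rewrite mul1n fresh ?asc_P // => x; apply: nbr_P.
case=> {k l} [s l desc_g short
  |s t k adj_st /andP [k_gt1 lt_k] desc_g desc_k ndesc_k short|s t adj_st desc_g].
- rewrite /= (bigID (adj s)) [LHS]addnC /=; congr addn.
    rewrite sum_fresh => [|u /andP [//]|u x /andP [_ nadj] adj_ux].
      rewrite -(card_non_nbr s); congr muln; apply: eq_bigl => u.
      by rewrite desc_g.
    by rewrite desc_g /=; apply: contraNneq nadj => <-; rewrite (coxeter_adj_sym cox).
  rewrite -(nbr_sumE s); apply: eq_big => u; rewrite desc_g /=.
    by case: eqP => // ->; rewrite coxeter_adj_irr.
  case/andP => neq_us adj_su; apply: paired => //; first by rewrite desc_g.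
  by rewrite short.
- rewrite /= leqNgt k_gt1 lt_k (bigID (adj s)) [LHS]addnC /= -addnA; congr addn.
    rewrite sum_fresh => [|u /andP [//]|u x /andP [_ nadj] adj_ux].
      rewrite -(card_non_nbr s); congr muln; apply: eq_bigl => u.
      by rewrite desc_g.
    by rewrite desc_g /=; apply: contraNneq nadj => <-; rewrite (coxeter_adj_sym cox).
  have asc_t : ~~ descent g t.
    by rewrite desc_g /= eq_sym; case/andP: adj_st.
  rewrite (bigD1 t) ?asc_t //= addnC; congr addn.
    rewrite -(nbr_sum_except _ adj_st); apply: eq_big => u; rewrite desc_g /=.
      by case: eqP => // ->; rewrite coxeter_adj_irr.
    case/andP => /andP [neq_us adj_su] neq_ut; apply: paired => //.
      by rewrite desc_g.
    by rewrite short.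
  rewrite m_sym -(prednK (ltnW k_gt1)); apply/IH/ascent_alternating => //.
  + by rewrite (coxeter_adj_sym cox).
  + by rewrite prednK // ltnW.
  + by rewrite prednK // ltnW.
- have [desc_s desc_t] : descent g s /\ descent g t by rewrite !desc_g /= !eqxx orbT.
  have [neq_st _] := andP adj_st.
  have pair_sum a b : adj a b -> descent g =1 pred2 a b ->
      (\sum_(u | adj a u && (u != b)) extensions r (g * val u)
       = nbr_sum (c 2) - c 2 (m a b))%N.
    move=> adj_ab desc_ab; rewrite -(nbr_sum_except _ adj_ab).
    apply: eq_bigr => u /andP [adj_au neq_ub].
    have neq_ua : u != a by apply: contraTneq adj_au => ->; rewrite coxeter_adj_irr.
    apply: paired => //; first by rewrite desc_ab /= negb_or neq_ua.
      move=> x adj_ux; rewrite desc_ab /=; case: (x =P b) => [def_x|]; rewrite ?orbF //.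
      rewrite def_x (coxeter_adj_sym cox) in adj_ux.
      by rewrite (no_triangle adj_ab adj_ux) in adj_au.
    by apply: full_fresh neq_ub; rewrite ?desc_ab //= ?eqxx ?orbT //; case/andP: adj_ab.
  rewrite /= leqNgt adj_label_gt1 // ltnn [LHS](bigID (adj s)) /=.
  rewrite [X in (_ + X = _)%N](bigID (adj t)) /= addnA [LHS]addnC; congr addn.
    rewrite sum_fresh => [|u|u x].
    + rewrite -(card_non_nbr2 adj_st); congr muln; apply: eq_bigl => u.
      rewrite desc_g /= -andbA; case: eqP => [->|_]; first by
        rewrite (coxeter_adj_sym cox) adj_st !andbF.
      by case: eqP => // ->; rewrite adj_st.
    + by case/andP => /andP [].
    + case/andP => /andP [_ nadj_s] nadj_t adj_ux; rewrite desc_g /= negb_or.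
      apply/andP; split.
        by apply: contraNneq nadj_s => <-; rewrite (coxeter_adj_sym cox).
      by apply: contraNneq nadj_t => <-; rewrite (coxeter_adj_sym cox).
  rewrite mul2n -addnn; congr addn.
    rewrite -pair_sum //; apply: eq_bigl => u; rewrite desc_g /= negb_or andbC.
    by case: (u =P s) => [->|]; rewrite ?coxeter_adj_irr.
  rewrite m_sym -pair_sum //; first last.
  + by move=> x; rewrite desc_g /= orbC.
  + by rewrite (coxeter_adj_sym cox).
  apply: eq_bigl => u; rewrite desc_g /= negb_or andbC.
  case: (u =P t) => [->|_]; first by rewrite coxeter_adj_irr.
  rewrite andbT; case: (boolP (adj t u)) => //= adj_tu.
  by rewrite (no_triangle adj_st adj_tu) andbT.
Qed.

Lemma extensions1 r :
  extensions r.+1 1 = (n * cone_growth n nbr_sum r 1 0)%N.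
Proof.
have no_descent s : ~~ descent 1 s by rewrite /descent word_length1.
set c := cone_growth _ _ _ _ _; rewrite -[n]sum1_card big_distrl /=.
apply: eq_big => u; first by rewrite no_descent.
move=> _; rewrite mul1n; apply: extensions_cone; exact: ascent_fresh.
Qed.

End CoxeterWords.

(** * Stars *)

(** The sum runs over ordered pairs, so each edge is counted twice before halving;
    no vertex is singled out, which makes invariance under isomorphism immediate. *)
Definition edge_sum (A : lgraph) (f : nat -> nat) : nat :=
  (\sum_(x : vertex A) \sum_(y | adj x y) f (elab x y))./2.

Lemma edge_sum_iso (A B : lgraph) : lgraph_iso A B -> edge_sum A = edge_sum B.
Proof.
case=> h [bij_h adj_h elab_h]; apply/funext => f; congr _./2.
rewrite [RHS](reindex h) /=; last exact: onW_bij.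
apply: eq_bigr => x _; rewrite [RHS](reindex h) /=; last exact: onW_bij.
by apply: eq_big => y; [rewrite adj_h | move=> adj_xy; rewrite elab_h].
Qed.

Lemma sum_sig (T : finType) (N P : pred T) (F : T -> nat) :
  \sum_(x : {x | N x} | P (val x)) F (val x) = \sum_(x | N x && P x) F x.
Proof.
rewrite [RHS](reindex_omap (val : {x | N x} -> T) insub) => [|x /andP [N_x _]].
  by apply: eq_bigl => x; rewrite (valP x) valK eqxx andbT.
by rewrite insubT.
Qed.

(** Without triangles, every edge of a star contains its centre. *)
Lemma edge_sum_star (A : lgraph) (v : vertex A) (f : nat -> nat) :
  triangle_free A ->
  edge_sum (star v) f = \sum_(u | adj v u) f (elab v u).
Proof.
move=> tri_free; pose N (x : vertex A) := (x == v) || adj v x.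
have adj_vN x : adj v x -> N x by rewrite /N => ->; rewrite orbT.
rewrite /edge_sum -[RHS]doubleK -addnn; congr _./2.
transitivity (\sum_(x | N x) \sum_(y | N y && adj x y) f (elab x y)).
  under [RHS]eq_bigl => x do rewrite -[N x]andbT.
  rewrite -(sum_sig N xpredT); apply: eq_bigr => x _.
  exact: (sum_sig N (adj (val x)) (fun y => f (elab (val x) y))).
rewrite (bigD1 v) /=; last by rewrite /N eqxx.
congr addn.
  by apply: eq_bigl => y; case: (boolP (adj v y)) => [/adj_vN ->|]; rewrite ?andbF.
apply: eq_big => [x|x /andP [N_x neq_xv]].
  by rewrite /N; case: eqP => [->|_]; rewrite ?andbT ?adj_irr ?andbF.
have adj_vx : adj v x by move: N_x; rewrite /N (negPf neq_xv).
rewrite (big_pred1 v) => [|y]; first by rewrite (elab_sym adj_vx).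
rewrite /N /=; case: eqP => [->|_] /=; first by rewrite adj_sym.
apply/negP => /andP [adj_vy adj_xy]; move: (tri_free v x y).
by rewrite adj_vx adj_xy adj_vy.
Qed.

Definition star_growth (n : nat) (A : lgraph) (r : nat) : nat :=
  if r is r'.+1 then n * cone_growth n (edge_sum A) r' 1 0 else 1.

Lemma geodesic_growth_star (G : groupType) (S : {fset G}) (m : S -> S -> nat)
    (cox : coxeter_system m) (v : vertex (coxeter_graph cox)) :
    even_system m -> triangle_free (coxeter_graph cox) ->
    star_regular (coxeter_graph cox) ->
  geodesic_growth S =1 star_growth #|` S| (star v).
Proof.
move=> m_even tri_free star_reg r; rewrite (geodesic_growth_extensions cox).
case: r => [//|r]; rewrite cardfE.
apply: (extensions1 m_even tri_free) => s f.
rewrite -(edge_sum_iso (star_reg s v)).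
exact: esym (@edge_sum_star (coxeter_graph cox) s f tri_free).
Qed.

Lemma geodesic_growth_fset0 (G : groupType) (S : {fset G}) (m : S -> S -> nat)
    (cox : coxeter_system m) r :
  #|` S| = 0 -> geodesic_growth S r = (r == 0).
Proof.
move=> S0; rewrite (geodesic_growth_extensions cox); case: r => [//|r] /=.
by rewrite big1 // => s; case: (fintype0 s); rewrite -cardfE.
Qed.

Local Open Scope fset_scope.

Theorem theorem6p15 :
  (exists F : nat -> lgraph -> nat -> nat,
     (forall (n : nat) (A B : lgraph), lgraph_iso A B -> F n A =1 F n B) /\
     (forall (G : groupType) (S : {fset G}) (m : S -> S -> nat)
             (cox : coxeter_system m),
        even_system m ->
        triangle_free (coxeter_graph cox) ->
        star_regular (coxeter_graph cox) ->
        forall v : vertex (coxeter_graph cox),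
          geodesic_growth S =1 F #|` S| (star v)))
  /\
  (forall (G1 G2 : groupType) (S1 : {fset G1}) (S2 : {fset G2})
          (m1 : S1 -> S1 -> nat) (m2 : S2 -> S2 -> nat)
          (cox1 : coxeter_system m1) (cox2 : coxeter_system m2),
     even_system m1 -> even_system m2 ->
     triangle_free (coxeter_graph cox1) -> triangle_free (coxeter_graph cox2) ->
     star_regular (coxeter_graph cox1) -> star_regular (coxeter_graph cox2) ->
     #|` S1| = #|` S2| ->
     (forall (v : vertex (coxeter_graph cox1)) (u : vertex (coxeter_graph cox2)),
        lgraph_iso (star v) (star u)) ->
     geodesic_growth S1 =1 geodesic_growth S2).
Proof.
split.
  exists star_growth; split=> [n A B iso_AB r|G S m cox even_m tri star_reg v].
    by rewrite /star_growth (edge_sum_iso iso_AB).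
  exact: geodesic_growth_star.
move=> G1 G2 S1 S2 m1 m2 cox1 cox2 even1 even2 tri1 tri2 reg1 reg2 eqS iso r.
(* Without generators there are no stars to compare. *)
have [S1_0|] := posnP #|` S1|.
  by rewrite (geodesic_growth_fset0 cox1) // (geodesic_growth_fset0 cox2) -?eqS.
rewrite {1}cardfE => /card_gt0P [v _].
have: 0 < #|` S2| by rewrite -eqS cardfE; apply/card_gt0P; exists v.
rewrite cardfE => /card_gt0P [u _].
rewrite (@geodesic_growth_star _ _ _ cox1 v) // (@geodesic_growth_star _ _ _ cox2 u) //.
by rewrite -eqS /star_growth (edge_sum_iso (iso v u)).
Qed.
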